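(* Let $0<q<1$ and let $\{\tilde p_n(z;q)\}_{n\in\mathbb N_0}$ and $\{\hat p_n(z;q)\}_{n\in\mathbb N_0}$ be conjugate odd $q$-Lidstone sequences of type II, with numerical sequences $(\tilde\alpha_{2n})_n$ and $(\tilde\beta_{2n})_n$ respectively. Put $\tilde g_q(t)=\sum_{n=0}^\infty\tilde\alpha_{2n}\frac{t^{2n}}{[2n+1]_q!}$. Then, as formal power series in $t$, $$\tilde g_q(t)\,\frac{\mathrm{Sinh}_q(zt)}{t}=\sum_{n=0}^\infty\tilde p_n(z;q)\frac{t^{2n}}{[2n+1]_q!},\qquad \frac{1}{\tilde g_q(t)}\,\frac{\mathrm{Sinh}_q(zt)}{t}=\sum_{n=0}^\infty\hat p_n(z;q)\frac{t^{2n}}{[2n+1]_q!}.$$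
   Context: Fix $0<q<1$. Put $[m]_q=\frac{1-q^m}{1-q}$, $[m]_q!=\prod_{j=1}^m[j]_q$, $[0]_q!=1$, and ${n \brack k}_q=\frac{[n]_q!}{[k]_q!\,[n-k]_q!}$ for $0\le k\le n$. $\mathbb N_0=\{0,1,2,\dots\}$. Odd $q$-Lidstone sequences of type II are the polynomial sequences of the form $\tilde p_n(z;q)=\sum_{k=0}^n{2n+1 \brack 2k+1}_q\frac{q^{k(2k+1)}\,\tilde\alpha_{2(n-k)}}{[2(n-k)+1]_q}z^{2k+1}$ $(n\in\mathbb N_0)$, where $(\tilde\alpha_{2k})_{k\ge0}$ is a sequence of real numbers with $\tilde\alpha_0\ne0$. Let $(\tilde\beta_{2n})_{n\ge0}$ be the unique real sequence with $\sum_{j=0}^n\frac{\tilde\beta_{2j}\,\tilde\alpha_{2(n-j)}}{[2j+1]_q!\,[2(n-j)+1]_q!}=\delta_{n0}$ for all $n\in\mathbb N_0$. The conjugate sequence of $\{\tilde p_n\}_n$ is $\hat p_n(z;q)=\sum_{k=0}^n{2n+1 \brack 2k+1}_q\frac{q^{k(2k+1)}\,\tilde\beta_{2(n-k)}}{[2(n-k)+1]_q}z^{2k+1}$. $\mathrm{Sinh}_q(x)=\sinh_{1/q}(x)=\sum_{n=0}^\infty q^{n(2n+1)}\frac{x^{2n+1}}{[2n+1]_q!}$. Since $\tilde\alpha_0\neq0$, $\tilde g_q(t)$ is invertible as a power series. *)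

(* Defs.v *)
From HB Require Import structures.
From mathcomp Require Import all_boot all_order all_algebra.
From mathcomp Require Import boolp reals.

Set Implicit Arguments.
Unset Strict Implicit.
Unset Printing Implicit Defensive.

Import GRing.Theory.
Local Open Scope ring_scope.

(* Formal power series in one variable t, given by their coefficients:
   the series f is the formal sum of the f n * t^n. *)
Record fps (A : Type) : Type := Fps { fps_coef : nat -> A }.

Coercion fps_coef : fps >-> Funclass.

HB.instance Definition _ (A : Type) := gen_eqMixin (fps A).
HB.instance Definition _ (A : Type) := gen_choiceMixin (fps A).

Lemma fpsP (A : Type) (f g : fps A) : f =1 g <-> f = g.
Proof.
by split=> [|->//]; case: f g => [f] [g] /= fg; congr Fps; apply: funext.
Qed.

Section FpsZmodule.
Variable A : zmodType.
Implicit Types f g h : fps A.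

Definition fps_zero : fps A := Fps (fun=> 0).
Definition fps_opp f : fps A := Fps (fun n => - f n).
Definition fps_add f g : fps A := Fps (fun n => f n + g n).

Fact fps_addA : associative fps_add.
Proof. by move=> f g h; apply/fpsP => n /=; rewrite addrA. Qed.

Fact fps_addC : commutative fps_add.
Proof. by move=> f g; apply/fpsP => n /=; rewrite addrC. Qed.

Fact fps_add0 : left_id fps_zero fps_add.
Proof. by move=> f; apply/fpsP => n /=; rewrite add0r. Qed.

Fact fps_addN : left_inverse fps_zero fps_opp fps_add.
Proof. by move=> f; apply/fpsP => n /=; rewrite addNr. Qed.

HB.instance Definition _ :=
  GRing.isZmodule.Build (fps A) fps_addA fps_addC fps_add0 fps_addN.

End FpsZmodule.

Section FpsRing.
Variable A : comNzRingType.
Implicit Types f g h : fps A.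

Definition fps_one : fps A := Fps (fun n => (n == 0%N)%:R).
Definition fps_mul f g : fps A :=
  Fps (fun n => \sum_(i < n.+1) f i * g (n - i)%N).

Definition fps_trunc (N : nat) f : {poly A} := \poly_(i < N) f i.

Fact coef_fps_mul N f g n : (n < N)%N ->
  fps_mul f g n = (fps_trunc N f * fps_trunc N g)`_n.
Proof.
move=> nN; rewrite coefM /=; apply: eq_bigr => i _; rewrite !coef_poly.
by rewrite (leq_ltn_trans (leq_ord i) nN) (leq_ltn_trans (leq_subr i n) nN).
Qed.

Fact fps_mulC : commutative fps_mul.
Proof.
by move=> f g; apply/fpsP => n; rewrite !(coef_fps_mul _ _ (ltnSn n)) mulrC.
Qed.

Fact fps_mulA : associative fps_mul.
Proof.
move=> f g h; apply/fpsP => n.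
transitivity
  ((fps_trunc n.+1 f * (fps_trunc n.+1 g * fps_trunc n.+1 h))`_n).
  rewrite coefM /=; apply: eq_bigr => i _; rewrite coef_poly ltn_ord.
  by rewrite -(@coef_fps_mul n.+1) // ltnS leq_subr.
rewrite mulrA coefM /=; apply: eq_bigr => i _.
by rewrite -(@coef_fps_mul n.+1) // coef_poly ltnS leq_subr.
Qed.

Fact fps_mul1 : left_id fps_one fps_mul.
Proof.
move=> f; apply/fpsP => n /=.
by rewrite big_ord_recl /= mul1r subn0 big1 ?addr0 // => i _; rewrite mul0r.
Qed.

Fact fps_mulD : left_distributive fps_mul (@fps_add A).
Proof.
move=> f g h; apply/fpsP => n /=.
by rewrite -big_split; apply: eq_bigr => i _; rewrite mulrDl.
Qed.

Fact fps_one_neq0 : fps_one != 0.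
Proof.
by apply/eqP => /fpsP/(_ 0%N)/eqP; rewrite /= oner_eq0.
Qed.

HB.instance Definition _ := GRing.Zmodule_isComNzRing.Build (fps A)
  fps_mulA fps_mulC fps_mul1 fps_mulD fps_one_neq0.

End FpsRing.

Section FpsUnitRing.
Variable A : comUnitRingType.
Implicit Types f g h : fps A.

Definition fps_unit : {pred fps A} := fun f => f 0%N \is a GRing.unit.

(* The list of the first N coefficients of the inverse of f. *)
Fixpoint fps_inv_seq f (N : nat) : seq A :=
  if N is n.+1 then
    let s := fps_inv_seq f n in
    rcons s ((f 0%N)^-1 * ((n == 0%N)%:R - \sum_(i < n) f (n - i)%N * s`_i))
  else [::].

Definition fps_inv f : fps A :=
  if f 0%N \is a GRing.unit then Fps (fun n => (fps_inv_seq f n.+1)`_n) else f.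

Fact size_fps_inv_seq f n : size (fps_inv_seq f n) = n.
Proof. by elim: n => //= n IHn; rewrite size_rcons IHn. Qed.

Fact nth_fps_inv_seq f n i : (i < n)%N ->
  (fps_inv_seq f n)`_i = (fps_inv_seq f i.+1)`_i.
Proof.
elim: n => // n IHn; rewrite ltnS leq_eqVlt => /predU1P[-> //|lt_in].
by rewrite /= nth_rcons size_fps_inv_seq lt_in IHn.
Qed.

Fact fps_mulV : {in fps_unit, left_inverse 1 fps_inv *%R}.
Proof.
move=> f; rewrite unfold_in => f0U; apply/fpsP => n.
rewrite /fps_inv f0U /= big_ord_recr /= subnn.
rewrite nth_rcons size_fps_inv_seq ltnn eqxx mulrAC mulVr // mul1r.
rewrite addrC -addrA (_ : - _ + _ = 0) ?addr0 //.
apply/eqP; rewrite addrC subr_eq0; apply/eqP; apply: eq_bigr => i _.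
by rewrite mulrC nth_fps_inv_seq.
Qed.

Fact fps_unitPl f g : g * f = 1 -> fps_unit f.
Proof.
move=> /fpsP/(_ 0%N); rewrite /= big_ord1 => gf1.
by apply/unitrPr; exists (g 0%N); rewrite mulrC.
Qed.

Fact fps_inv_out : {in [predC fps_unit], fps_inv =1 id}.
Proof.
by move=> f; rewrite inE /= unfold_in /fps_inv => /negbTE ->.
Qed.

HB.instance Definition _ := GRing.ComNzRing_hasMulInverse.Build (fps A)
  fps_mulV fps_unitPl fps_inv_out.

Lemma fps_unitE f : (f \is a GRing.unit) = (f 0%N \is a GRing.unit).
Proof. by []. Qed.

End FpsUnitRing.

Definition fps_map (A B : Type) (phi : A -> B) (f : fps A) : fps B :=
  Fps (fun n => phi (f n)).

Section FpsOperations.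
Variable A : comNzRingType.

Definition fpsX : fps A := Fps (fun n => (n == 1%N)%:R).

(* f(zt) *)
Definition fps_dilate (z : A) (f : fps A) : fps A :=
  Fps (fun n => z ^+ n * f n).

(* f(t) / t, for f without constant term (see fps_divXK). *)
Definition fps_divX (f : fps A) : fps A := Fps (fun n => f n.+1).

Lemma fps_divXK (f : fps A) : f 0%N = 0 -> fps_divX f * fpsX = f.
Proof.
move=> f0; apply/fpsP => -[|n] /=; first by rewrite big_ord1 mulr0 f0.
rewrite big_ord_recr big_ord_recr /= subnn mulr0 addr0 subSnn mulr1.
rewrite big1 ?add0r // => i _.
have lt_in := ltn_ord i; rewrite subSn ?(ltnW lt_in) // eqSS subn_eq0.
by rewrite leqNgt lt_in mulr0.
Qed.

(* \sum_n a_n t^(2n) *)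
Definition fps_even (a : nat -> A) : fps A :=
  Fps (fun m => if odd m then 0 else a m./2).

(* \sum_n a_n t^(2n+1) *)
Definition fps_odd (a : nat -> A) : fps A :=
  Fps (fun m => if odd m then a m./2 else 0).

End FpsOperations.

Section QLidstone.
Variables (R : realType) (q : R).

Definition qint (m : nat) : R := (1 - q ^+ m) / (1 - q).

Definition qfact (m : nat) : R := \prod_(1 <= j < m.+1) qint j.

(* Meant for k <= n. *)
Definition qbinom (n k : nat) : R := qfact n / (qfact k * qfact (n - k)).

(* In what follows, a numerical sequence indexed by the even integers is
   encoded as a : nat -> R, with a k standing for the term of index 2k. *)

Definition odd_qLidstone2 (a : nat -> R) (n : nat) : {poly R} :=
  \sum_(k < n.+1)
    (qbinom (2 * n + 1) (2 * k + 1)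
     * (q ^+ (k * (2 * k + 1)) * a (n - k)%N / qint (2 * (n - k) + 1)))
    *: 'X^(2 * k + 1).

Definition conjugate_seq (a b : nat -> R) : Prop :=
  forall n : nat,
    \sum_(j < n.+1)
      b j * a (n - j)%N / (qfact (2 * j + 1) * qfact (2 * (n - j) + 1))
    = (n == 0%N)%:R.

Definition Sinhq : fps R :=
  fps_odd (fun n => q ^+ (n * (2 * n + 1)) / qfact (2 * n + 1)).

Definition gtilde (a : nat -> R) : fps R :=
  fps_even (fun n => a n / qfact (2 * n + 1)).

(* Sinh_q(zt) / t, as a power series in t over the polynomials in z. *)
Definition Sinhq_zt_div_t : fps {poly R} :=
  fps_divX (fps_dilate 'X (fps_map polyC Sinhq)).

(* \sum_n p_n(z) t^(2n) / [2n+1]_q! *)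
Definition qLidstone_genfun (p : nat -> {poly R}) : fps {poly R} :=
  fps_even (fun n => (qfact (2 * n + 1))^-1 *: p n).

End QLidstone.

(* Main.v *)
Require Import Defs.
From HB Require Import structures.
From mathcomp Require Import all_boot all_order all_algebra.
From mathcomp Require Import boolp reals.
From mathcomp Require Import ring.
Import Order.TTheory GRing.Theory Num.Theory.
Local Open Scope ring_scope.

(** The series [t^(-1) Sinh_q(zt)] and [gtilde a] are both even in t, so their
    product is the even series of the Cauchy product of their coefficient
    sequences, and
    [[2n+1]_q! / ([2k+1]_q! [2(n-k)+1]_q!) = qbinom(2n+1, 2k+1) / [2(n-k)+1]_q]
    identifies it with the generating function of the Lidstone sequence of [a].
    The relation between alpha and beta says that [gtilde beta] is the inverse
    of [gtilde alpha], so the second identity is the first one for beta. *)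

Lemma sum_ord_even (V : zmodType) (F : nat -> V) (n : nat) :
  (forall i, odd i -> F i = 0) ->
  \sum_(i < n.*2.+1) F i = \sum_(j < n.+1) F j.*2.
Proof.
move=> F_odd; elim: n => [|n IHn]; first by rewrite !big_ord1.
rewrite doubleS 2!big_ord_recr /= IHn [RHS]big_ord_recr /= doubleS.
by rewrite [F n.*2.+1]F_odd ?addr0 //= odd_double.
Qed.

Lemma fps_evenM (A : comNzRingType) (a b : nat -> A) :
  fps_even a * fps_even b =
  fps_even (fun n => \sum_(j < n.+1) a j * b (n - j)%N).
Proof.
apply/fpsP => m /=; case: ifPn => [m_odd | m_even].
  (* As [m] is odd, [i] and [m - i] have opposite parities, so one factor vanishes. *)
  apply: big1 => i _; rewrite oddB ?leq_ord // m_odd /=.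
  by case: (odd i); rewrite ?mul0r ?mulr0.
rewrite -[m in LHS](even_halfK m_even); set n := m./2.
(* The summand is extended to all of [nat]; its first factor already kills the odd [i]. *)
rewrite (sum_ord_even _
  (fun i => (if odd i then 0 else a i./2)
    * (if odd (n.*2 - i) then 0 else b (n.*2 - i)./2))) => [|i ->].
  by apply: eq_bigr => j _; rewrite -doubleB !odd_double !doubleK.
by rewrite mul0r.
Qed.

Lemma fps_even_delta (A : comNzRingType) :
  fps_even (fun n => (n == 0%N)%:R) = 1 :> fps A.
Proof. by apply/fpsP => -[|[|m]] //=; case: ifP. Qed.

Lemma fps_map_even (A B : comNzRingType) (phi : {rmorphism A -> B})
    (a : nat -> A) :
  fps_map phi (fps_even a) = fps_even (phi \o a).
Proof. by apply/fpsP => m /=; case: ifP => // _; rewrite rmorph0. Qed.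

Section QLidstoneGenfun.
Variables (R : realType) (q : R).
Hypothesis hq : 0 < q < 1.

Lemma qint_neq0 m : (0 < m)%N -> qint q m != 0.
Proof.
case/andP: hq => q_gt0 q_lt1 m_gt0; rewrite /qint mulf_neq0 //.
  by rewrite subr_eq0 gt_eqF // exprn_ilt1 ?ltW // -lt0n.
by rewrite invr_eq0 subr_eq0 gt_eqF.
Qed.

Lemma qfactS m : qfact q m.+1 = qfact q m * qint q m.+1.
Proof. by rewrite /qfact big_nat_recr. Qed.

Lemma qfact_neq0 m : qfact q m != 0.
Proof.
elim: m => [|m IHm]; first by rewrite /qfact big_geq ?oner_eq0.
by rewrite qfactS mulf_neq0 ?qint_neq0.
Qed.

Lemma Sinhq_zt_div_tE :
  Sinhq_zt_div_t q = fps_even (fun n =>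
    (q ^+ (n * (2 * n + 1)) / qfact q (2 * n + 1)) *: 'X^(2 * n + 1)).
Proof.
apply/fpsP => m /=; case: ifPn => [m_even | /negPn ->]; last first.
  by rewrite polyC0 mulr0.
(* Division by t shifts the index: the coefficient at an even [m] is the one of [Sinhq] at [m.+1],
   whose half is still [m./2]. *)
have mE : (2 * m./2 + 1 = m.+1)%N by rewrite mul2n even_halfK ?addn1.
by rewrite (negbTE m_even) uphalf_half (negbTE m_even) add0n mE mulrC mul_polyC.
Qed.

Lemma gtilde_genfun (a : nat -> R) :
  fps_map polyC (gtilde q a) * Sinhq_zt_div_t q
    = qLidstone_genfun q (odd_qLidstone2 q a).
Proof.
(* Commuting the factors makes the summation index that of the power of z, as in
   [odd_qLidstone2]. *)
rewrite Sinhq_zt_div_tE /gtilde fps_map_even mulrC fps_evenM.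
congr fps_even; apply: funext => n; rewrite scaler_sumr.
apply: eq_bigr => -[k /=]; rewrite ltnS => le_kn _.
rewrite mulrC mul_polyC !scalerA; congr (_ *: _).
rewrite /qbinom (_ : 2 * n + 1 - (2 * k + 1) = 2 * (n - k))%N; last first.
  by rewrite subnDr mulnBr.
(* The split-off last factor is the [qint] dividing in [odd_qLidstone2]; the remaining factorial is
   the one in [qbinom]. *)
rewrite [(2 * (n - k) + 1)%N]addn1 qfactS.
by field; rewrite !qfact_neq0 qint_neq0.
Qed.

Lemma gtilde_conjugate (a b : nat -> R) :
  conjugate_seq q a b -> (gtilde q a)^-1 = gtilde q b.
Proof.
(* The order [b], [a] is that of the convolution in [conjugate_seq]. *)
move=> ab; have ba1 : gtilde q b * gtilde q a = 1.
  rewrite fps_evenM -fps_even_delta; congr fps_even; apply: funext => n.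
  by rewrite -ab; apply: eq_bigr => j _; rewrite mulf_div.
have a_unit : gtilde q a \is a GRing.unit by apply: (fps_unitPl ba1).
by apply: (mulIr a_unit); rewrite mulVr.
Qed.

End QLidstoneGenfun.

Theorem theorem4p11 (R : realType) (q : R) (alpha beta : nat -> R)
    (p phat : nat -> {poly R})
    (hq : 0 < q < 1)
    (halpha : alpha 0%N != 0)
    (hbeta : conjugate_seq q alpha beta)
    (hp : forall n : nat, p n = odd_qLidstone2 q alpha n)
    (hphat : forall n : nat, phat n = odd_qLidstone2 q beta n) :
  fps_map polyC (gtilde q alpha) * Sinhq_zt_div_t q = qLidstone_genfun q p
  /\
  fps_map polyC (gtilde q alpha)^-1 * Sinhq_zt_div_t q
    = qLidstone_genfun q phat.
Proof.
by rewrite (gtilde_conjugate _ _ _ _ hbeta) (funext hp) (funext hphat) !gtilde_genfun.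
Qed.
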